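(* Let $\mathcal{I}$ be a set of items and let $D$ be a timestamped transaction database over $\mathcal{I}$. Let $P, P' \subseteq \mathcal{I}$ be itemsets with $P' \supseteq P$. Then for every integer $l$ and every integer $W > 0$, $$\mathit{sup}(P', l, W) \leq \mathit{sup}(P, l, W).$$
   Context: A timestamped transaction database over an item universe $\mathcal{I}$ is a finite set $D = \{(T_t, t)\}$ of pairs, with timestamps $t \in \mathbb{Z}_{\geq 0}$, where $T_t \subseteq \mathcal{I}$ is the (single) transaction corresponding to timestamp $t$. An itemset is a subset $P \subseteq \mathcal{I}$. The occurrence timestamp sequence of $P$ in $D$ is $\mathit{occ}(P) = \{t \mid P \subseteq T_t,\ (T_t, t) \in D\}$. For a window size $W > 0$ and a window $[l, l+W]$, the interval support of $P$ is $$\mathit{sup}(P, l, W) = |\{t \in \mathit{occ}(P) \mid l \leq t \leq l + W\}|.$$ *)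

(* Defs.v *)
From HB Require Import structures.
From mathcomp Require Import all_boot all_order all_algebra.
From mathcomp Require Import finmap.
From mathcomp Require Import mathcomp_extra boolp classical_sets functions cardinality.
Set Implicit Arguments.
Unset Strict Implicit.
Unset Printing Implicit Defensive.

Local Open Scope classical_set_scope.

(* The item universe is a type [I], possibly infinite; itemsets
   and transactions are arbitrary elements of [set I]. *)

Record tdb (I : Type) := Tdb {
  tdb_entries : set (set I * nat);
  tdb_finite : finite_set tdb_entries;
  tdb_single : forall (T T' : set I) (t : nat),
    tdb_entries (T, t) -> tdb_entries (T', t) -> T = T' }.

Definition occ (I : Type) (D : tdb I) (P : set I) : set nat :=
  [set t : nat | exists2 T : set I, P `<=` T & tdb_entries D (T, t)].

Definition window_occ (I : Type) (D : tdb I) (P : set I) (l W : int) : set nat :=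
  [set t : nat | occ D P t /\ (l <= t%:Z <= l + W)%R].

Lemma finite_occ (I : Type) (D : tdb I) (P : set I) : finite_set (occ D P).
Proof.
apply: (sub_finite_set _ (finite_image snd (tdb_finite D))).
by move=> t [T _ DTt]; exists (T, t).
Qed.

(* [fset_set] returns the empty set on infinite sets; this lemma shows that the
   cardinal taken in [interval_support] is never such a default value. *)
Lemma finite_window_occ (I : Type) (D : tdb I) (P : set I) (l W : int) :
  finite_set (window_occ D P l W).
Proof. by apply: sub_finite_set (finite_occ D P) => t []. Qed.

Definition interval_support (I : Type) (D : tdb I) (P : set I) (l W : int) : nat :=
  #|` fset_set (window_occ D P l W)|%fset.

(* Main.v *)
Require Import Defs.
From mathcomp Require Import all_boot all_order all_algebra.
From mathcomp Require Import finmap.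
From mathcomp Require Import mathcomp_extra boolp classical_sets functions cardinality.

Local Open Scope classical_set_scope.

(** Any transaction containing [P'] also contains [P], so support can only shrink as the itemset
    grows ([occ_antimono]). Restricting to a common window keeps the inclusion, and cardinality is
    monotone on finite sets. *)

Lemma occ_antimono (I : Type) (D : tdb I) (P P' : set I) :
  P `<=` P' -> occ D P' `<=` occ D P.
Proof.
by move=> PP' t [T P'T DTt]; exists T => //; apply: subset_trans P'T.
Qed.

Theorem proposition1 (I : Type) (D : tdb I) (P P' : set I) (hPP' : P `<=` P')
    (l W : int) (hW : (0 < W)%R) :
  (interval_support D P' l W <= interval_support D P l W)%N.
Proof.
apply: fsubset_leq_card.
(* Inclusion passes through [fset_set] because both window sets are finite; an infinite one would be
   sent to the empty set. *)
rewrite -fset_set_sub; try exact: finite_window_occ.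
by move=> t [P't lt]; split=> //; exact: occ_antimono P't.
Qed.
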